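(* Let $r,e,w$ be non-negative integers with $e>r\ge 3$. Let $\mu$ and $\nu$ be distinct compositions of $r$. Then: (a) $\mathcal{W}_{r,e,w}(\mu)\cap\mathcal{W}_{r,e,w}(\nu)=\varnothing$. (b) The set $\mathcal{W}_{r,e,w}(\mu)$ is a disjoint union of copies of the simplex $\mathcal{W}_{r,e}(\mu)$, and the number of copies is exactly $A(\mu;w)$.
   Context: Partitions and abaci. A composition of $r$ is a finite sequence of positive integers with sum $r$; its length is its number of terms. A partition is a finite weakly decreasing sequence $\lambda=(\lambda_1,\lambda_2,\dots)$ of positive integers, with $\ell(\lambda)$ parts and size $|\lambda|$; set $\lambda_i=0$ for $i>\ell(\lambda)$. If $\ell(\lambda)\le r$, its $r$-beta numbers are $\beta_i(\lambda)=\lambda_i+r-i$ for $1\le i\le r$ (strictly decreasing non-negative integers, which determine $\lambda$). The $e$-abacus of $\lambda$ with $r$ beads has runners $0,\dots,e-1$ and rows $0,1,2,\dots$; the bead $\beta_i(\lambda)=ae+b$, $0\le b\le e-1$, is placed in row $a$ of runner $b$. Sliding a bead up means moving it from position $x$ to the empty position $x-e\ge 0$. Sliding all beads up as far as possible gives the $e$-abacus of a partition $\operatorname{core}_e(\lambda)$, and the total number of one-step slides is the $e$-weight $w_e(\lambda)$. Weights. Let $P=\bigoplus_{i=1}^{r-1}\mathbb{Z}\Lambda_i$ be the weight lattice of $\mathfrak{sl}_r$ with fundamental weights $\Lambda_i$, and for $\ell(\lambda)\le r$ put $\Omega(\lambda)=\sum_{i=1}^{r-1}(\beta_i(\lambda)-\beta_{i+1}(\lambda))\Lambda_i$.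 The sets. For a composition $\mu=(\mu_1,\dots,\mu_j)$ of $r$, let $\mathscr{P}_{r,e}(\mu)$ be the set of partitions whose $e$-abacus with $r$ beads is obtained by choosing runners $0\le s_1<\cdots<s_j\le e-1$ and placing $\mu_i$ beads as high as possible on runner $s_i$ (rows $0,\dots,\mu_i-1$) for each $i$, all other runners being empty. Put $\mathcal{W}_{r,e}(\mu)=\Omega(\mathscr{P}_{r,e}(\mu))$. Let $\mathscr{P}_{r,e,w}(\mu)$ be the set of partitions $\lambda$ with $\ell(\lambda)\le r$, $w_e(\lambda)=w$ and $\operatorname{core}_e(\lambda)\in\mathscr{P}_{r,e}(\mu)$, and put $\mathcal{W}_{r,e,w}(\mu)=\Omega(\mathscr{P}_{r,e,w}(\mu))$. The number $A(\mu;w)$. For $\mu=(\mu_1,\dots,\mu_j)$, a $j$-partition of $w$ of type $\mu$ is a tuple of partitions $(q^{(1)},\dots,q^{(j)})$ with $\sum_i|q^{(i)}|=w$ and $\ell(q^{(i)})\le\mu_i$ for all $i$; $A(\mu;w)$ is the number of these. Simplex terminology. For integers $d\ge 0$, $L>0$ let $\Delta^d(L)=\{(x_0,\dots,x_d)\in\mathbb{R}_{\ge 0}^{d+1}:x_0+\cdots+x_d=L\}$. A subset $S\subset P$ is said to form the lattice points of a $d$-dimensional simplex of dilation factor $L$ if there is an injective affine linear map $\phi:\mathbb{R}^{d+1}\to P\otimes\mathbb{R}$ with $S=\phi(\Delta^d(L)\cap\mathbb{Z}^{d+1})$. The set $\mathcal{W}_{r,e}(\mu)$ is called a simplex in this sense,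 with $d=j-1$ and $L=e-j$. Copies. The word ''copy'' refers to the following: each $\lambda\in\mathscr{P}_{r,e,w}(\mu)$ is obtained from a partition in $\mathscr{P}_{r,e}(\mu)$ by moving beads down on the $j$ non-empty runners, and these moves are recorded by a $j$-partition of $w$ of type $\mu$ (its $i$-th entry is the partition whose $\mu_i$-beta numbers are the row indices of the beads on the $i$-th non-empty runner); for a fixed such $j$-partition, the weights $\Omega(\lambda)$ of the corresponding $\lambda$ make up one copy of $\mathcal{W}_{r,e}(\mu)$.
   Formalization: The affine map φ defining a simplex is required to be injective only on the hyperplane x_0+...+x_d=L, not on all of R^{d+1}; for μ=(1^r) no injective affine map from R^r to the (r-1)-dimensional P⊗R exists, and for j<r the two conditions are equivalent. *)

(* Defs.v *)
From HB Require Import structures.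
From mathcomp Require Import all_boot all_order all_algebra finmap.
From mathcomp Require Import all_classical reals.

Set Implicit Arguments.
Unset Strict Implicit.
Unset Printing Implicit Defensive.

Import Order.TTheory GRing.Theory Num.Theory.

Local Open Scope classical_set_scope.
Local Open Scope nat_scope.

Definition is_composition (r : nat) (mu : seq nat) : bool :=
  (0 \notin mu) && (sumn mu == r).

Definition is_partition (lam : seq nat) : bool :=
  (0 \notin lam) && sorted geq lam.

(* Indices are shifted by one: entry i is beta_{i+1} = lam_{i+1} + r - (i+1).
   The subtraction never truncates, since i < r. *)
Definition beta (r : nat) (lam : seq nat) : seq nat :=
  [seq nth 0 lam i + r - i.+1 | i <- iota 0 r].

(* Position x of the e-abacus is row x %/ e of runner x %% e. *)
Definition abacus (r : nat) (lam : seq nat) : {fset nat} :=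
  [fset x in beta r lam]%fset.

Definition slide (e : nat) (B C : {fset nat}) : Prop :=
  exists x, [/\ x \in B, e <= x, x - e \notin B & C = ((x - e) |` (B `\ x))%fset].

Fixpoint slides (e n : nat) (B C : {fset nat}) : Prop :=
  if n is n'.+1 then exists D, slide e B D /\ slides e n' D C else B = C.

Definition fully_slid (e : nat) (B : {fset nat}) : Prop :=
  forall C, ~ slide e B C.

Definition is_core (r e : nat) (lam kappa : seq nat) : Prop :=
  [/\ is_partition kappa, size kappa <= r, fully_slid e (abacus r kappa) &
      exists n, slides e n (abacus r lam) (abacus r kappa)].

Definition is_weight (r e : nat) (lam : seq nat) (w : nat) : Prop :=
  exists2 C, slides e w (abacus r lam) C & fully_slid e C.

(* The lattice P is 'rV[int]_(r.-1), in the basis of fundamental weights: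
   column i is the coefficient of Lambda_{i+1}. *)
Definition Omega (r : nat) (lam : seq nat) : 'rV[int]_(r.-1) :=
  (\row_(i < r.-1)
    ((nth 0 (beta r lam) i)%:Z - (nth 0 (beta r lam) i.+1)%:Z))%R.

Definition Pcore (r e : nat) (mu : seq nat) : set (seq nat) :=
  [set lam | [/\ is_partition lam, size lam <= r &
    exists s : seq nat,
      [/\ size s = size mu, sorted ltn s, all (fun b => b < e) s &
          abacus r lam =i [seq a * e + nth 0 s i
                          | i <- iota 0 (size mu), a <- iota 0 (nth 0 mu i)]]]].

Definition Wcore (r e : nat) (mu : seq nat) : set 'rV[int]_(r.-1) :=
  Omega r @` Pcore r e mu.

Definition Pweight (r e w : nat) (mu : seq nat) : set (seq nat) :=
  [set lam | [/\ is_partition lam, size lam <= r, is_weight r e lam w &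
    exists2 kappa, is_core r e lam kappa & Pcore r e mu kappa]].

Definition Wweight (r e w : nat) (mu : seq nat) : set 'rV[int]_(r.-1) :=
  Omega r @` Pweight r e w mu.

Definition is_jpartition (mu : seq nat) (w : nat) (q : seq (seq nat)) : bool :=
  [&& size q == size mu, all is_partition q,
      all2 leq (map size q) mu & sumn (map sumn q) == w].

Definition jpartitions (mu : seq nat) (w : nat) : set (seq (seq nat)) :=
  [set q | is_jpartition mu w q].

Lemma leq_sumn (s : seq nat) x : x \in s -> x <= sumn s.
Proof.
elim: s => //= y s IH; rewrite inE => /predU1P[->|/IH xs].
  exact: leq_addr.
exact: leq_trans xs (leq_addl _ _).
Qed.

Lemma size_leq_sumn (s : seq nat) : 0 \notin s -> size s <= sumn s.
Proof.
elim: s => //= y s IH; rewrite inE negb_or => /andP[y0 /IH]; case: y y0 => //.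
by move=> y _ le_s; rewrite addSn ltnS (leq_trans le_s) ?leq_addl.
Qed.

Lemma finite_jpartitions mu w : finite_set (jpartitions mu w).
Proof.
pose dec (t : (size mu).-tuple (w.-bseq 'I_w.+1)) : seq (seq nat) :=
  [seq [seq val x | x <- bseqval p] | p <- t].
apply: (@sub_finite_set _ _ (dec @` setT)); last exact: finite_image.
move=> q /and4P[/eqP sq /allP qP _ /eqP wq].
have le_w p : p \in q -> sumn p <= w.
  by move=> pq; rewrite -wq; apply/leq_sumn/map_f.
pose enc (p : seq nat) : w.-bseq 'I_w.+1 := insub_bseq w [seq inord x | x <- p].
have stq : size [seq enc p | p <- q] == size mu by rewrite size_map sq.
exists (Tuple stq) => //.
rewrite /dec /= -map_comp -[RHS]map_id; apply/eq_in_map => p pq /=.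
have /andP[p0 _] := qP p pq.
rewrite val_insubd size_map (leq_trans (size_leq_sumn p0)) ?le_w //.
rewrite -map_comp -[RHS]map_id; apply/eq_in_map => x xp /=.
by rewrite inordK // ltnS (leq_trans (leq_sumn xp)) ?le_w.
Qed.

Definition A (mu : seq nat) (w : nat) : nat := #|` fset_set (jpartitions mu w)|%fset.

Definition nonempty_runners (r e : nat) (lam : seq nat) : seq nat :=
  [seq b <- iota 0 e | b \in [seq x %% e | x <- beta r lam]].

(* Rows of the beads on runner b, in decreasing order (as in beta r lam). *)
Definition runner_rows (r e : nat) (lam : seq nat) (b : nat) : seq nat :=
  [seq x %/ e | x <- beta r lam & x %% e == b].

(* q records the moves leading to lam from a partition in Pcore r e mu. *)
Definition records (r e : nat) (mu lam : seq nat) (q : seq (seq nat)) : Prop :=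
  forall i, i < size mu ->
    runner_rows r e lam (nth 0 (nonempty_runners r e lam) i) =
    beta (nth 0 mu i) (nth [::] q i).

Definition copy (r e w : nat) (mu : seq nat) (q : seq (seq nat)) :
    set 'rV[int]_(r.-1) :=
  Omega r @` [set lam | Pweight r e w mu lam /\ records r e mu lam q].

Arguments Wcore : clear implicits.
Arguments Wweight : clear implicits.
Arguments copy : clear implicits.

Section Simplex.
Local Open Scope ring_scope.
Variable R : realType.

Definition to_real (n : nat) : 'rV[int]_n -> 'rV[R]_n := map_mx intr.

Definition hyperplane (d L : nat) : set 'rV[R]_d.+1 :=
  [set x | \sum_i x 0 i = L%:R].

Definition Delta (d L : nat) : set 'rV[R]_d.+1 :=
  [set x | hyperplane L x /\ forall i, 0 <= x 0 i].

(* The affine map phi = f + v is required to be injective on the affine hull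
   of the simplex (L > 0). If d + 1 <= m, such a phi can be changed off that
   hyperplane to be injective on all of R^(d+1), so nothing is lost; if
   d + 1 = m + 1 (the composition (1^r), with d = r - 1 = m), no affine map
   from R^(d+1) to R^m is injective. *)
Definition simplex_points (m d L : nat) (S : set 'rV[int]_m) : Prop :=
  exists (f : {linear 'rV[R]_d.+1 -> 'rV[R]_m}) (v : 'rV[R]_m),
    let phi := fun x => f x + v in
    set_inj (@hyperplane d L) phi /\
    @to_real m @` S = phi @` (Delta L `&` range (@to_real d.+1)).

End Simplex.

(* Main.v *)
(* Write l for the list of beta numbers of lam and j for the length
   of mu.  Sliding beads keeps the number of beads on each runner and lowers the
   sum of the rows by one, so lam lies in P_{r,e,w}(mu) exactly when the
   non-empty runners carry mu_1, ..., mu_j beads and the sum of the rows is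
   w + sum_i C(mu_i, 2).
   Omega(lam) determines l up to a shift x |-> x + c.  A shift preserves the
   number of pairs of beads on a common runner, so equality of the weights w
   forces it to leave every row unchanged; then no runner wraps around, and mu
   and the j-partition can be read off Omega(lam).
   For a fixed j-partition the beads, listed in decreasing order, are
   a_k e + s_{i_k} where a_k and i_k do not depend on the chosen runners s; hence
   Omega is an affine function of the gaps s_{i+1} - s_i - 1, which, with the
   last one closed up cyclically, range over the lattice points of the
   simplex. *)
Require Import Defs.
From mathcomp Require Import all_boot all_order all_algebra finmap.
From mathcomp Require Import all_classical reals.
From mathcomp Require Import zify ring lra.

Set Implicit Arguments.
Unset Strict Implicit.
Unset Printing Implicit Defensive.

Import Order.TTheory GRing.Theory Num.Theory.

Local Open Scope classical_set_scope.
Local Open Scope nat_scope.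

(** * Beta numbers *)

Lemma gtn_sorted_eq (s t : seq nat) :
  sorted gtn s -> sorted gtn t -> s =i t -> s = t.
Proof.
apply: irr_sorted_eq; first by move=> y x z /= yx zy; apply: ltn_trans yx.
exact: ltnn.
Qed.

Lemma gtn_sorted_uniq (s : seq nat) : sorted gtn s -> uniq s.
Proof.
apply: sorted_uniq; last exact: ltnn.
by move=> y x z /= yx zy; apply: ltn_trans yx.
Qed.

Lemma sort_gtn (s : seq nat) : uniq s -> sorted gtn (sort geq s).
Proof.
move=> us.
have : sorted geq (sort geq s) by apply: sort_sorted => x y; apply: leq_total.
have : uniq (sort geq s) by rewrite sort_uniq.
elim: (sort geq s) => //= x t IH /andP[xt ut] p.
move: IH xt p ut; case: t => //= y t IH xy /andP[yx yt] ut.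
rewrite IH // andbT ltn_neqAle yx andbT.
by apply: contraNneq xy => ->; rewrite mem_head.
Qed.

Lemma size_beta n p : size (beta n p) = n.
Proof. by rewrite size_map size_iota. Qed.

Lemma beta_rec n p : beta n.+1 p = head 0 p + n :: beta n (behead p).
Proof.
rewrite /beta /= -nth0 addnS subn1 /=; congr cons.
rewrite -[1]/(1 + 0) iotaDl -map_comp; apply: eq_map => i /=.
by rewrite add1n nth_behead; lia.
Qed.

Lemma is_partition_cons x p :
  is_partition (x :: p) = [&& 0 < x, head 0 p <= x & is_partition p].
Proof.
rewrite /is_partition inE negb_or eq_sym -lt0n.
case: p => [|y p] /=; first by rewrite !andbT.
by rewrite -!andbA; do !bool_congr.
Qed.

Lemma is_partition_behead p : is_partition p -> is_partition (behead p).
Proof. by case: p => // x p; rewrite is_partition_cons => /and3P[]. Qed.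

Lemma beta_sorted n p : is_partition p -> sorted gtn (beta n p).
Proof.
elim: n p => // n IH p pP; rewrite beta_rec /=.
have := IH _ (is_partition_behead pP).
case: n {IH} => // n; rewrite beta_rec /= => ->; rewrite andbT.
case: p pP => [|x p]; first by rewrite /=; lia.
by rewrite is_partition_cons => /and3P[_ + _] /=; lia.
Qed.

(** Peeling off first entries leaves only the case of one empty and one non-empty list, where equal
    heads would make a positive part zero. *)
Lemma beta_inj n p p' : is_partition p -> is_partition p' ->
  size p <= n -> size p' <= n -> beta n p = beta n p' -> p = p'.
Proof.
elim: n p p' => [|n IH] p p' pP pP'.
  by rewrite !leqn0 !size_eq0 => /eqP-> /eqP->.
move=> sp sp'; rewrite !beta_rec => -[/addIn hd].
move/(IH _ _ (is_partition_behead pP) (is_partition_behead pP')).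
rewrite !size_behead => /(_ _ _)/wrap[]; [lia..|].
case: p p' pP pP' hd {sp sp' IH} => [|x p] [|x' p'] //=;
  rewrite ?is_partition_cons.
- by move=> _ /andP[+ _] xx; rewrite -xx.
- by move=> /andP[+ _] _ xx; rewrite xx.
- by move=> _ _ -> ->.
Qed.

(** The entry [x] forces the first part [x - size l], and strict decrease makes it at least as large
    as the next part. *)
Lemma beta_surj l : sorted gtn l ->
  exists p, [/\ is_partition p, size p <= size l & beta (size l) p = l].
Proof.
elim: l => [_|x l IH xl]; first by exists [::].
have [p [pP sp bp]] := IH (path_sorted xl).
have hl : if size l is n.+1 then head 0 p + n < x else true.
  case: (l) xl bp => //= y l' /andP[yx _].
  by rewrite beta_rec => -[-> _].
have lx : head 0 p + size l <= x by case: (size l) hl sp => [|n];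
  [case: (p) => //= | lia].
case: (ltngtP x (size l)) => [|xs|xs]; first lia.
- exists (x - size l :: p); rewrite is_partition_cons pP /= ltnS sp.
  split=> //; first by apply/and3P; split=> //; lia.
  by rewrite beta_rec /= bp subnK // ltnW.
(* The new part would be 0 here; then the head of [p] is 0 as well, so [p] is empty. *)
- exists [::]; split=> //; rewrite /= beta_rec /=.
  move: pP bp; case: (p) lx => [|y p'] /=; first by move=> _ _ ->; rewrite xs.
  by rewrite is_partition_cons => ? /andP[]; lia.
Qed.

Lemma sumn_beta n p : size p <= n -> sumn (beta n p) = sumn p + 'C(n, 2).
Proof.
elim: n p => [|n IH] p; first by rewrite leqn0 => /nilP->.
move=> sp; rewrite beta_rec binS bin1 /= IH ?size_behead; last by lia.
by case: p sp => [|x p] /=; lia.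
Qed.

Lemma beta_nil_iota n : beta n [::] =i iota 0 n.
Proof.
elim: n => // n IH x; rewrite beta_rec -addn1 iotaD mem_cat inE /= IH add0n inE.
by rewrite orbC.
Qed.

(** * Rows and runners *)

Section Rows.
Variable e : nat.
Hypothesis e_gt0 : 0 < e.

Definition rows (l : seq nat) (b : nat) : seq nat :=
  [seq x %/ e | x <- l & x %% e == b].

Definition runners (l : seq nat) : seq nat :=
  [seq b <- iota 0 e | b \in [seq x %% e | x <- l]].

Definition rowsum (l : seq nat) : nat := \sum_(x <- l) x %/ e.

Lemma mem_rows l b a : b < e -> (a \in rows l b) = (a * e + b \in l).
Proof.
move=> be; apply/mapP/idP => [[x]|abl].
  by rewrite mem_filter => /andP[/eqP<- xl] ->; rewrite -divn_eq.
exists (a * e + b); last by rewrite divnMDl // divn_small ?addn0.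
by rewrite mem_filter abl modnMDl modn_small ?eqxx.
Qed.

Lemma rows_sorted l b : sorted gtn l -> sorted gtn (rows l b).
Proof.
move=> sl; rewrite sorted_map.
have tr : transitive gtn by move=> y x z /= yx zy; apply: ltn_trans yx.
have := sorted_filter tr (fun x => x %% e == b) sl.
apply: (sub_in_sorted (P := fun x => x %% e == b)) (filter_all _ _).
move=> x y /= /eqP xb /eqP yb.
by rewrite {1}(divn_eq x e) {1}(divn_eq y e) xb yb ltn_add2r ltn_pmul2r.
Qed.

Lemma size_rows l b : size (rows l b) = count (fun x => x %% e == b) l.
Proof. by rewrite size_map size_filter. Qed.

Lemma runners_lt l b : b \in runners l -> b < e.
Proof. by rewrite mem_filter mem_iota => /and3P[]. Qed.

Lemma mem_runners l b : (b \in runners l) = (0 < size (rows l b)) && (b < e).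
Proof.
rewrite mem_filter mem_iota /= add0n; congr andb; rewrite size_rows -has_count.
by apply/mapP/hasP => [[x xl ->]|[x xl /eqP<-]]; exists x.
Qed.

Lemma runners_sorted l : sorted ltn (runners l).
Proof. by apply: sorted_filter (iota_ltn_sorted _ _); apply: ltn_trans. Qed.

Lemma rows_nil l b : b \notin runners l -> b < e -> rows l b = [::].
Proof. by rewrite mem_runners => + be; rewrite be andbT lt0n negbK => /nilP. Qed.

(** Beads are regrouped by runner for an arbitrary summand, which serves the row sum, the number of
    pairs and the number of beads alike. *)
Lemma sum_rows (F : nat -> nat -> nat) l :
  \sum_(x <- l) F (x %% e) (x %/ e) =
  \sum_(b <- runners l) \sum_(a <- rows l b) F b a.
Proof.
rewrite [RHS]big_filter [RHS]big_mkcond /=.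
transitivity (\sum_(0 <= b < e) \sum_(a <- rows l b) F b a); last first.
  rewrite /index_iota subn0; apply: eq_big_seq => b.
  rewrite mem_iota => /andP[_ be].
  case: ifP => // bl; rewrite rows_nil ?big_nil //.
  by rewrite mem_filter bl.
under [RHS]eq_bigr do rewrite big_map big_filter.
rewrite (exchange_big_dep predT) //=; apply: eq_big_seq => x _.
rewrite [RHS]big_mkcond (bigD1_seq (x %% e)) ?iota_uniq ?eqxx //=; last first.
  by rewrite mem_index_iota ltn_mod.
by rewrite big1 ?addn0 // => b /negPf; rewrite eq_sym => ->.
Qed.

Lemma rowsum_rows l : rowsum l = \sum_(b <- runners l) sumn (rows l b).
Proof.
rewrite /rowsum (sum_rows (fun _ a => a)).
by apply: eq_bigr => b _; rewrite sumnE.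
Qed.

(** Counts ordered pairs of beads on a common runner, a bead with itself included. Only congruence
    modulo [e] enters, so shift invariance is immediate. *)
Definition pairs (l : seq nat) : nat :=
  \sum_(x <- l) count (fun y => y %% e == x %% e) l.

Lemma pairs_rows l : pairs l = \sum_(b <- runners l) size (rows l b) ^ 2.
Proof.
rewrite /pairs (sum_rows (fun b _ => count (fun y => y %% e == b) l)).
apply: eq_bigr => b _.
by rewrite -size_rows big_const_seq count_predT iter_addn_0 expnS expn1.
Qed.

Lemma size_sum_rows l : size l = \sum_(b <- runners l) size (rows l b).
Proof.
rewrite -sum1_size (sum_rows (fun _ _ => 1)).
by apply: eq_bigr => b _; rewrite sum1_size.
Qed.

Lemma mem_rowsE l x : (x \in l) = (x %/ e \in rows l (x %% e)).
Proof. by rewrite mem_rows ?ltn_mod // -divn_eq. Qed.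

Lemma eq_rows l l' : sorted gtn l -> sorted gtn l' ->
  (forall b, b < e -> rows l b =i rows l' b) -> l = l'.
Proof.
move=> sl sl' ll'; apply: gtn_sorted_eq => // x.
by rewrite (mem_rowsE l) (mem_rowsE l') ll' ?ltn_mod.
Qed.

Lemma runners_eq l s : sorted ltn s -> all (fun b => b < e) s ->
  (forall b, b < e -> (b \in s) = (0 < size (rows l b))) -> runners l = s.
Proof.
move=> ss /allP se sl; apply: (irr_sorted_eq ltn_trans ltnn) => //.
  exact: runners_sorted.
move=> b; rewrite mem_runners; case: (ltnP b e) => [be|eb].
  by rewrite sl // andbT.
by rewrite andbF; apply/esym/negbTE/negP => /se; rewrite ltnNge eb.
Qed.

End Rows.

(** * Sliding beads *)

(** A member [a] brings along all of [0, ..., a], so [a < size t]; counting turns this inclusion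
    into an equality. *)
Lemma eq_mem_iota (t : seq nat) :
  uniq t -> (forall a, a.+1 \in t -> a \in t) -> t =i iota 0 (size t).
Proof.
move=> ut down.
have dl a : a \in t -> {subset iota 0 a.+1 <= t}.
  elim: a => [t0|a IH ta] x; first by rewrite mem_iota ltnS leqn0 => /eqP->.
  rewrite mem_iota /= add0n ltnS leq_eqVlt => /predU1P[->//|xa].
  by apply: IH; [apply: down | rewrite mem_iota].
have sub : {subset t <= iota 0 (size t)}.
  move=> a ta; rewrite mem_iota add0n /=.
  by have := uniq_leq_size (iota_uniq 0 a.+1) (dl a ta); rewrite size_iota.
by have [] := uniq_min_size ut sub; rewrite ?size_iota.
Qed.

Lemma perm_abacus r lam : is_partition lam ->
  perm_eq (abacus r lam) (beta r lam).
Proof.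
move=> /(beta_sorted r)/gtn_sorted_uniq ul.
by apply: uniq_perm => // x; rewrite inE.
Qed.

Lemma mem_abacus r lam : abacus r lam =i beta r lam.
Proof. by move=> x; rewrite inE. Qed.

Lemma abacus_surj (C : {fset nat}) : exists kappa,
  [/\ is_partition kappa, size kappa <= #|` C| & abacus #|` C| kappa = C]%fset.
Proof.
have [kappa [kP sk bk]] := beta_surj (sort_gtn (fset_uniq C)).
rewrite size_sort in sk bk; exists kappa; split=> //.
by apply/fsetP => x; rewrite inE /= bk mem_sort.
Qed.

Section Slides.
Variable e : nat.
Hypothesis e_gt0 : 0 < e.

Definition residues (l : seq nat) : seq nat := [seq x %% e | x <- l].

Lemma size_rows_residues l l' b : perm_eq (residues l) (residues l') ->
  size (rows e l b) = size (rows e l' b).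
Proof.
by move=> /permP/(_ (pred1 b)); rewrite !size_rows !count_map.
Qed.

Lemma perm_residues l l' : perm_eq l l' -> perm_eq (residues l) (residues l').
Proof. exact: perm_map. Qed.

(** Passing from [x] to [x - e] keeps the residue and lowers the quotient by one. Hence the row sum
    counts slides, whatever their order. *)
Lemma slide_residues B C : slide e B C ->
  perm_eq (residues B) (residues C) /\ rowsum e B = (rowsum e C).+1.
Proof.
move=> [x [xB ex xeB CE]].
have pB : perm_eq B (x :: (B `\ x)%fset).
  apply: uniq_perm => [||y]; rewrite ?fset_uniq //=.
    by rewrite fset_uniq andbT !inE eqxx.
  by rewrite -[RHS]/(y \in x :: _) !inE; case: eqVneq => [->|].
have pC : perm_eq C (x - e :: (B `\ x)%fset).
  rewrite CE; apply: uniq_perm => [||y]; rewrite ?fset_uniq //=.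
    by rewrite fset_uniq andbT !inE (negPf xeB) andbF.
  by rewrite -[RHS]/(y \in x - e :: _) !inE.
rewrite /rowsum (perm_big _ pB) (perm_big _ pC) !big_cons /=.
have xE : x %/ e = ((x - e) %/ e).+1.
  by rewrite -{1}(subnK ex) divnDr // divnn e_gt0 addn1.
split; last by rewrite xE addSn.
apply: (perm_trans (perm_residues pB)).
rewrite perm_sym; apply: (perm_trans (perm_residues pC)).
have xm : x %% e = (x - e) %% e by rewrite -{1}(subnK ex) modnDr.
by rewrite /= xm.
Qed.

Lemma slides_residues n B C : slides e n B C ->
  perm_eq (residues B) (residues C) /\ rowsum e B = n + rowsum e C.
Proof.
elim: n B => [B ->//|n IH B [D [/slide_residues[p1 s1] /IH[p2 s2]]]].
by split; [apply: perm_trans p2 | rewrite s1 s2].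
Qed.

(** The row sum drops at each slide, so sliding stops. *)
Lemma slides_exist B : exists n C, slides e n B C /\ fully_slid e C.
Proof.
have [m] := ubnP (rowsum e B); elim: m B => // m IH B Bm.
have [fB|] := pselect (fully_slid e B); first by exists 0, B.
move=> /existsNP[D /contrapT BD].
have [n [C [DC fC]]] : exists n C, slides e n D C /\ fully_slid e C.
  by apply: IH; have [_ sD] := slide_residues BD; rewrite sD in Bm.
by exists n.+1, C; split=> //; exists D.
Qed.

(** A bead in row [a.+1] with row [a] empty could slide, so the rows in use on a runner are closed
    under predecessors. *)
Lemma fully_slid_rows r kappa b : is_partition kappa -> b < e ->
  fully_slid e (abacus r kappa) ->
  rows e (beta r kappa) b =i iota 0 (size (rows e (beta r kappa) b)).
Proof.
move=> kP be fk; apply: eq_mem_iota.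
  by apply/gtn_sorted_uniq/rows_sorted/beta_sorted.
move=> a; rewrite !mem_rows // -!mem_abacus => aB.
apply/negPn/negP => aN; apply: (fk _).
exists (a.+1 * e + b); split=> //; first by rewrite mulSn -addnA leq_addr.
by rewrite mulSn -addnA addKn.
Qed.

Definition runner_sizes (l : seq nat) : seq nat :=
  [seq size (rows e l b) | b <- runners e l].

(** The chosen runners can only be the non-empty ones, because [0 \notin mu] puts a bead on each of
    them; this removes the existential over [s]. *)
Lemma PcoreP r mu kappa : 0 \notin mu ->
  Pcore r e mu kappa <->
  [/\ is_partition kappa, size kappa <= r, mu = runner_sizes (beta r kappa) &
    forall b, b < e ->
      rows e (beta r kappa) b =i iota 0 (size (rows e (beta r kappa) b))].
Proof.
move=> mu0; split=> [[kP sk [s [ss ssort /allP se kE]]]|[kP sk muE kE]]; last first.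
  split=> //; exists (runners e (beta r kappa)); split.
  - by rewrite muE size_map.
  - exact: runners_sorted.
  - by apply/allP => b; apply: runners_lt.
  move=> x; rewrite mem_abacus (mem_rowsE e_gt0) kE ?ltn_mod // mem_iota /= add0n.
  set l := beta r kappa; apply/idP/allpairsPdep => [xl|].
    have xr : x %% e \in runners e l.
      by rewrite mem_runners ltn_mod e_gt0 andbT; apply: leq_ltn_trans xl.
    exists (index (x %% e) (runners e l)), (x %/ e).
    rewrite nth_index // -divn_eq mem_iota muE size_map /= add0n index_mem xr.
    by split=> //; rewrite mem_iota /= (nth_map 0) ?index_mem // nth_index.
  move=> [i [a [+ + ->]]]; rewrite !mem_iota !add0n /= muE size_map => il.
  have be : nth 0 (runners e l) i < e by apply: runners_lt (mem_nth 0 il).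
  by rewrite (nth_map 0) // divnMDl // modnMDl modn_small // divn_small // addn0.
set l := beta r kappa.
have us : uniq s by apply: sorted_uniq ssort; [apply: ltn_trans | apply: ltnn].
have rE b a : b < e ->
    a \in rows e l b <-> exists2 i, i < size mu & a < nth 0 mu i /\ b = nth 0 s i.
  move=> be; rewrite mem_rows // -mem_abacus kE; split.
    move=> /allpairsPdep[i [a' [+ + aE]]]; rewrite !mem_iota !add0n /= => im a'm.
    have ie : nth 0 s i < e by apply/se/mem_nth; rewrite ss.
    have := congr1 (modn^~ e) aE; have := congr1 (divn^~ e) aE.
    rewrite !divnMDl // !modnMDl !modn_small // !divn_small // !addn0 => -> ->.
    by exists i.
  move=> [i im [am ->]]; apply/allpairsPdep; exists i, a.
  by rewrite !mem_iota.
have rs i : i < size mu -> rows e l (nth 0 s i) =i iota 0 (nth 0 mu i).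
  move=> im a; have be : nth 0 s i < e by apply/se/mem_nth; rewrite ss.
  rewrite mem_iota add0n /=; apply/idP/idP => [/(rE _ _ be)[k km [ak /eqP]]|am].
    by rewrite nth_uniq ?ss // => /eqP->.
  by apply/rE => //; exists i.
have ul b : uniq (rows e l b).
  by apply/gtn_sorted_uniq/rows_sorted/beta_sorted.
have rsz i : i < size mu -> size (rows e l (nth 0 s i)) = nth 0 mu i.
  move=> /rs/(uniq_perm (ul _) (iota_uniq _ _))/perm_size ->.
  by rewrite size_iota.
have runs : runners e l = s.
  apply: runners_eq => // [|b be]; first exact/allP.
  apply/idP/idP => [bs|].
    rewrite -(nth_index 0 bs) rsz -?ss ?index_mem // lt0n.
    by apply: contraNneq mu0 => <-; rewrite mem_nth // -ss index_mem.
  case rb : (rows e l b) => [//|a t] _.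
  have : a \in rows e l b by rewrite rb mem_head.
  by move=> /(rE _ _ be)[i im [_ ->]]; rewrite mem_nth // ss.
split=> //.
  rewrite /runner_sizes runs; apply: (@eq_from_nth _ 0); first by rewrite size_map.
  by move=> i im; rewrite (nth_map 0) ?ss // rsz.
move=> b be; have [bs|bs] := boolP (b \in s).
  by rewrite -(nth_index 0 bs) rsz ?rs -?ss ?index_mem //; apply: rs;
    rewrite -ss index_mem.
by rewrite rows_nil ?runs.
Qed.

Lemma rowsum_Pcore r mu kappa : 0 \notin mu -> Pcore r e mu kappa ->
  rowsum e (beta r kappa) = \sum_(m <- mu) 'C(m, 2).
Proof.
move=> mu0 /(PcoreP _ _ mu0)[kP _ -> kE].
rewrite rowsum_rows // big_map; apply: eq_big_seq => b /runners_lt be.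
rewrite !sumnE (perm_big (iota 0 (size (rows e (beta r kappa) b)))) /=.
  by rewrite -bin2_sum /index_iota subn0.
apply: uniq_perm; rewrite ?iota_uniq //; last exact: kE.
by apply/gtn_sorted_uniq/rows_sorted/beta_sorted.
Qed.

Lemma runner_sizes_residues l l' : perm_eq (residues l) (residues l') ->
  runners e l = runners e l' /\ runner_sizes l = runner_sizes l'.
Proof.
move=> p; have rE : runners e l = runners e l'.
  by apply: eq_filter => b; rewrite (perm_mem p).
by split=> //; rewrite /runner_sizes rE; apply: eq_map => b;
  apply: size_rows_residues.
Qed.

(** Slides preserve the runner sizes and lower the row sum by one each, and the row sum of the core
    depends only on [mu]. From here on slides need not be considered. *)
Lemma PweightP r w mu lam : 0 \notin mu ->
  Pweight r e w mu lam <->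
  [/\ is_partition lam, size lam <= r, mu = runner_sizes (beta r lam) &
    rowsum e (beta r lam) = w + \sum_(m <- mu) 'C(m, 2)].
Proof.
move=> mu0.
have slides_beta n lam' kappa : is_partition lam' -> is_partition kappa ->
    slides e n (abacus r lam') (abacus r kappa) ->
    perm_eq (residues (beta r lam')) (residues (beta r kappa)) /\
    rowsum e (beta r lam') = n + rowsum e (beta r kappa).
  move=> lP kP /slides_residues[]; rewrite /rowsum.
  rewrite !(perm_big _ (perm_abacus r lP)) !(perm_big _ (perm_abacus r kP)).
  move=> p sE; split=> //; apply: perm_trans (perm_trans p _); last first.
    exact/perm_residues/perm_abacus.
  by rewrite perm_sym; apply/perm_residues/perm_abacus.
(* Slides keep the number of beads, so whatever they reach is the [r]-bead abacus of a partition. *)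
have partC n C : is_partition lam -> slides e n (abacus r lam) C -> exists kappa,
    [/\ is_partition kappa, size kappa <= r & abacus r kappa = C].
  move=> lP /slides_residues[/perm_size + _]; rewrite !size_map => sC.
  have [kappa] := abacus_surj C.
  have -> : #|` C|%fset = r.
    by rewrite -sC (perm_size (perm_abacus r lP)) size_beta.
  by case=> ? ? ?; exists kappa.
split.
  move=> [lP sl [C lC fC] [kappa [kP sk fk [n ln]] kmu]].
  have [k' [k'P sk' k'C]] := partC _ _ lP lC; subst C.
  have [p1 s1] := slides_beta _ _ _ lP kP ln.
  have [p2 s2] := slides_beta _ _ _ lP k'P lC.
  (* [kappa] and [k'] may end different slide sequences, but both are fully slid with the same
     runner sizes. *)
  have kk' : beta r kappa = beta r k'.
    apply: (eq_rows e_gt0); try exact: beta_sorted.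
    move=> b be a; rewrite !fully_slid_rows //.
    by rewrite -(size_rows_residues b p1) -(size_rows_residues b p2).
  have [_ r1] := runner_sizes_residues p1.
  split=> //; first by rewrite r1; have [] := (PcoreP r kappa mu0).1 kmu.
  by rewrite s2 -kk' (rowsum_Pcore mu0 kmu).
move=> [lP sl muE sumE].
have [n [C [lC fC]]] := slides_exist (abacus r lam).
have [kappa [kP sk kC]] := partC _ _ lP lC; subst C.
have [p1 s1] := slides_beta _ _ _ lP kP lC.
have [_ r1] := runner_sizes_residues p1.
have kmu : Pcore r e mu kappa.
  apply/PcoreP => //; split=> //; first by rewrite -r1.
  by move=> b be; apply: fully_slid_rows.
have nw : n = w.
  by move: s1; rewrite sumE (rowsum_Pcore mu0 kmu) => /addIn.
split=> //; first by exists (abacus r kappa) => //; rewrite -nw.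
by exists kappa => //; split=> //; exists n.
Qed.

End Slides.

(** * Shifts of the beta numbers *)

Lemma leq_sum_eq (l : seq nat) (F G : nat -> nat) :
  (forall x, F x <= G x) -> \sum_(x <- l) F x = \sum_(x <- l) G x ->
  {in l, F =1 G}.
Proof.
move=> FG; elim: l => [|y l IH]; first by [].
rewrite !big_cons => sE x.
have sl : \sum_(x <- l) F x <= \sum_(x <- l) G x by apply: leq_sum.
have Fy := FG y.
by rewrite inE => /predU1P[->|/IH]; [lia | apply; lia].
Qed.

Lemma bin2_double m : 'C(m, 2) * 2 + m = m ^ 2.
Proof. by rewrite bin2; elim: m => // m IH; rewrite /= expnS expn1; lia. Qed.

Section Shift.
Variable e : nat.
Hypothesis e_gt0 : 0 < e.

(** The identity [m ^ 2 = 2 * 'C(m, 2) + m], summed over the runners, expresses the binomial sum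
    through shift-invariant quantities. *)
Lemma bin2_runner_sizes l :
  (\sum_(m <- runner_sizes e l) 'C(m, 2)) * 2 + size l = pairs e l.
Proof.
rewrite pairs_rows // (size_sum_rows e_gt0 l) big_map big_distrl -big_split /=.
by apply: eq_bigr => b _; rewrite bin2_double.
Qed.

Lemma pairs_shift c l : pairs e (map (addn c) l) = pairs e l.
Proof.
rewrite /pairs big_map; apply: eq_bigr => x _; rewrite count_map.
by apply: eq_count => y /=; rewrite eqn_modDl.
Qed.

(* A shift that moves some runner past the last one increases the sum of the
   rows but not the number of pairs, hence changes the weight. *)
Lemma shift_rows c w l (l' := map (addn c) l) :
  rowsum e l = w + \sum_(m <- runner_sizes e l) 'C(m, 2) ->
  rowsum e l' = w + \sum_(m <- runner_sizes e l') 'C(m, 2) ->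
  map (rows e l') (runners e l') = map (rows e l) (runners e l).
Proof.
move=> wl wl'.
have dE : {in l, (fun x => x %/ e) =1 (fun x => (c + x) %/ e)}.
  apply: leq_sum_eq => [x|]; first by apply: leq_div2r; apply: leq_addl.
  have -> : \sum_(x <- l) (c + x) %/ e = rowsum e l' by rewrite /rowsum big_map.
  rewrite -/(rowsum e l) wl wl'; congr addn.
  have := bin2_runner_sizes l; rewrite -(pairs_shift c) -/l' -bin2_runner_sizes.
  by rewrite /l' size_map; lia.
(* With the quotients unchanged, adding [c] never carries a residue past [e]. *)
have mE : {in l, forall x, (c + x) %% e = c + x %% e}.
  move=> x /dE xE; have := divn_eq (c + x) e; have := divn_eq x e; rewrite xE; lia.
have rE : runners e l' = map (addn c) (runners e l).
  apply: (irr_sorted_eq ltn_trans ltnn).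
  - exact: runners_sorted.
  - rewrite sorted_map; apply: sub_sorted (runners_sorted _ _) => x y /=.
    by rewrite ltn_add2l.
  move=> b; rewrite mem_filter mem_iota /= add0n; apply/andP/mapP.
    move=> [/mapP[_ /mapP[x xl ->] ->] _]; exists (x %% e); last exact: mE.
    by rewrite mem_filter mem_iota ltn_mod e_gt0 /= andbT; apply: map_f.
  move=> [b']; rewrite mem_filter mem_iota => /and3P[/mapP[x xl ->] _ _] ->.
  rewrite -mE // ltn_mod; split=> //; apply: map_f (fun x => x %% e) _ _ _.
  exact: map_f.
rewrite rE -map_comp; apply: eq_map => b; rewrite /rows /= filter_map -map_comp.
have -> : [seq x <- l | preim (addn c) (fun x => x %% e == c + b) x] =
          [seq x <- l | x %% e == b].
  by apply: eq_in_filter => x xl /=; rewrite mE // eqn_add2l.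
by apply/eq_in_map => x; rewrite mem_filter => /andP[_ /dE ->].
Qed.

End Shift.

(** Consecutive differences fix the list up to a constant, which is read off at the largest bead;
    the inequality keeps the natural subtraction from truncating. *)
Lemma Omega_shift r lam lam' (l := beta r lam) (l' := beta r lam') :
  Omega r lam = Omega r lam' -> nth 0 l 0 <= nth 0 l' 0 ->
  l' = map (addn (nth 0 l' 0 - nth 0 l 0)) l.
Proof.
move=> /rowP OE ll'.
have step i : i < r -> nth 0 l' i + nth 0 l 0 = nth 0 l i + nth 0 l' 0.
  elim: i => [_|i IH ir]; first exact: addnC.
  have ir' : i < r.-1 by lia.
  have : ((nth 0%N l i)%:Z - (nth 0%N l i.+1)%:Z =
          (nth 0%N l' i)%:Z - (nth 0%N l' i.+1)%:Z :> int)%R.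
    by have := OE (Ordinal ir'); rewrite !mxE.
  by have := IH (ltnW ir); lia.
apply: (@eq_from_nth _ 0); rewrite !size_map // size_iota => i ir.
rewrite (nth_map 0) ?size_beta //; have := step i ir; lia.
Qed.

(** Two compositions are allowed so that one statement serves both disjointness for [mu <> nu] and,
    with [mu = nu], disjointness of the copies. *)
Lemma Pweight_Omega_inj r e w mu nu lam lam' (l := beta r lam) (l' := beta r lam') :
  0 < e -> 0 \notin mu -> 0 \notin nu ->
  Pweight r e w mu lam -> Pweight r e w nu lam' -> Omega r lam = Omega r lam' ->
  map (rows e l') (runners e l') = map (rows e l) (runners e l).
Proof.
(* The shift is by a natural number, so [l] is taken to be the list with the smaller first entry. *)
move=> e0; wlog ll' : mu nu lam lam' @l @l' / nth 0 l 0 <= nth 0 l' 0.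
  move=> H mu0 nu0 P P' OE; have /orP[ll'|ll'] := leq_total (nth 0 l 0) (nth 0 l' 0).
    exact: H ll' mu0 nu0 P P' OE.
  by apply/esym; apply: H ll' nu0 mu0 P' P (esym OE).
move=> mu0 nu0 /(PweightP e0 _ _ _ mu0)[_ _ muE lw] /(PweightP e0 _ _ _ nu0)[_ _ nuE lw'].
move=> /Omega_shift/(_ ll'); rewrite -/l -/l' => l'E; rewrite l'E.
by apply: (@shift_rows e e0 _ w); rewrite -?l'E; [rewrite -muE | rewrite -nuE].
Qed.

(** * Row lists and j-partitions *)

Lemma runner_sizes_rows e l :
  runner_sizes e l = map size (map (rows e l) (runners e l)).
Proof. by rewrite -map_comp. Qed.

Lemma jpartitionP mu w q : is_jpartition mu w q <->
  [/\ size q = size mu,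
    forall i, i < size mu ->
      is_partition (nth [::] q i) /\ size (nth [::] q i) <= nth 0 mu i &
    \sum_(i < size mu) sumn (nth [::] q i) = w].
Proof.
rewrite /is_jpartition all2E size_map; split.
  move=> /and4P[/eqP sq /allP qP /andP[_ /(all_nthP (0, 0))qs] /eqP <-].
  split=> //; last by rewrite sumnE big_map (big_nth [::]) big_mkord sq.
  move=> i im; split; first by apply/qP/mem_nth; rewrite sq.
  have := qs i; rewrite size_zip size_map sq minnn nth_zip ?size_map //=.
  by rewrite (nth_map [::]) ?sq //; apply.
move=> [sq qP <-]; rewrite sq eqxx /=; apply/and3P; split.
- by apply/(all_nthP [::]) => i; rewrite sq => /qP[].
- apply/(all_nthP (0, 0)) => i; rewrite size_zip size_map sq minnn => im.
  by rewrite nth_zip ?size_map //= (nth_map [::]) ?sq //; have [] := qP i im.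
- by rewrite sumnE big_map (big_nth [::]) big_mkord sq.
Qed.

Lemma records_rows r e mu lam q : records r e mu lam q ->
  size mu = size (runners e (beta r lam)) ->
  forall i, i < size mu ->
  nth [::] (map (rows e (beta r lam)) (runners e (beta r lam))) i =
  beta (nth 0 mu i) (nth [::] q i).
Proof. by move=> rec sr i im; rewrite (nth_map 0) -?sr // -rec. Qed.

Lemma jpartition_rows_inj mu w q w' q' :
  is_jpartition mu w q -> is_jpartition mu w' q' ->
  (forall i, i < size mu ->
    beta (nth 0 mu i) (nth [::] q i) = beta (nth 0 mu i) (nth [::] q' i)) ->
  q = q'.
Proof.
move=> /jpartitionP[sq qP _] /jpartitionP[sq' qP' _] qq'.
apply: (@eq_from_nth _ [::]); rewrite sq ?sq' // => i im.
have [p1 s1] := qP i im; have [p2 s2] := qP' i im.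
exact: beta_inj (qq' i im).
Qed.

Lemma sum_rows_jpartition mu w q (t : seq (seq nat)) :
  is_jpartition mu w q -> size t = size mu ->
  (forall i, i < size mu -> nth [::] t i = beta (nth 0 mu i) (nth [::] q i)) ->
  \sum_(x <- t) sumn x = w + \sum_(m <- mu) 'C(m, 2).
Proof.
move=> /jpartitionP[_ qP <-] st tE.
rewrite (big_nth [::]) big_mkord (big_nth 0) big_mkord st -big_split /=.
apply: eq_bigr => i _; rewrite tE ?ltn_ord // sumn_beta //.
by have [] := qP i (ltn_ord i).
Qed.

(** The rows on each non-empty runner are the beta numbers of a partition. Runner [i] adds
    ['C(mu_i, 2)] to the size of its partition, so the sizes total [w]. *)
Lemma jpartition_exists r e w mu lam : 0 < e -> 0 \notin mu ->
  Pweight r e w mu lam -> exists2 q, is_jpartition mu w q & records r e mu lam q.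
Proof.
move=> e0 mu0 /(PweightP e0 _ _ _ mu0)[lP _ muE lw]; set l := beta r lam in muE lw.
have ls b : sorted gtn (rows e l b) by apply/rows_sorted/beta_sorted.
have [f fP] := choice (fun b => beta_surj (ls b)).
have nE i : i < size (runners e l) ->
    nth 0 mu i = size (rows e l (nth 0 (runners e l) i)).
  by move=> il; rewrite muE (nth_map 0).
have smu : size mu = size (runners e l) by rewrite muE size_map.
exists [seq f b | b <- runners e l]; last first.
  move=> i im; rewrite smu in im; rewrite (nth_map 0) // nE //.
  by have [_ _ ->] := fP (nth 0 (runners e l) i).
apply/jpartitionP; rewrite size_map -smu; split=> // [i|].
  rewrite smu => im; rewrite (nth_map 0) // nE //.
  by have [] := fP (nth 0 (runners e l) i).
apply/eqP; rewrite -(eqn_add2r (\sum_(m <- mu) 'C(m, 2))) -lw rowsum_rows //.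
have -> : \sum_(m <- mu) 'C(m, 2) =
    \sum_(b <- runners e l) 'C(size (rows e l b), 2) by rewrite muE big_map.
have -> : \sum_(i < size mu) sumn (nth [::] [seq f b | b <- runners e l] i) =
    \sum_(b <- runners e l) sumn (f b).
  by rewrite (big_nth 0) big_mkord smu; apply: eq_bigr => i _; rewrite (nth_map 0).
rewrite -big_split; apply/eqP/eq_bigr => b _ /=; have [_ sz bE] := fP b.
by rewrite -[in RHS]bE sumn_beta.
Qed.

(** On an abacus with exactly [size t] runners, list [i] fills runner [i]. The result is the
    template of a copy; [place] inserts the empty runners later. *)
Lemma rows_exist (t : seq (seq nat)) : 0 < size t -> all (sorted gtn) t ->
  exists D, sorted gtn D /\ forall i, i < size t -> rows (size t) D i = nth [::] t i.
Proof.
move=> t0 /allP tS; set j := size t.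
pose X := [seq a * j + i | i <- iota 0 j, a <- nth [::] t i].
exists (sort geq (undup X)).
have sX : sorted gtn (sort geq (undup X)) by apply/sort_gtn/undup_uniq.
split=> // i ij; apply: gtn_sorted_eq; first exact: rows_sorted.
  by apply/tS/mem_nth.
move=> a; rewrite mem_rows // mem_sort mem_undup; apply/allpairsPdep/idP.
  move=> [i' [a' [+ + aE]]]; rewrite mem_iota /= add0n => i'j.
  have := congr1 (modn^~ j) aE; have := congr1 (divn^~ j) aE => /=.
  by rewrite !divnMDl // !modnMDl !modn_small // !divn_small // !addn0 => -> ->.
by move=> aE; exists i, a; rewrite mem_iota.
Qed.

(** * Placing beads on chosen runners *)

(** Moves runner [i] of the abacus with [size s] runners to runner [s_i] of the [e]-abacus, keeping
    the rows. *)
Definition place (e : nat) (s : seq nat) (x : nat) : nat :=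
  x %/ size s * e + nth 0 s (x %% size s).

Definition runner_choice (e j : nat) (s : seq nat) : Prop :=
  [/\ size s = j, sorted ltn s & all (fun b => b < e) s].

Section Place.
Variables (e j : nat) (s : seq nat).
Hypotheses (e_gt0 : 0 < e) (j_gt0 : 0 < j) (sP : runner_choice e j s).

Lemma runner_choice_lt i : i < j -> nth 0 s i < e.
Proof. by case: sP => sj _ /allP se ij; apply/se/mem_nth; rewrite sj. Qed.

Lemma place_div x : place e s x %/ e = x %/ j.
Proof.
case: sP => sj _ _; rewrite /place sj divnMDl //.
by rewrite [X in _ + X]divn_small ?addn0 // runner_choice_lt ?ltn_mod.
Qed.

Lemma place_mod x : place e s x %% e = nth 0 s (x %% j).
Proof.
case: sP => sj _ _; rewrite /place sj modnMDl.
by rewrite [LHS]modn_small // runner_choice_lt ?ltn_mod.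
Qed.

Lemma nth_runner_choice i k : i < j -> k < j -> (nth 0 s i == nth 0 s k) = (i == k).
Proof.
case: sP => sj ss _ ij kj; rewrite nth_uniq ?sj //.
by apply: sorted_uniq ss; [apply: ltn_trans | apply: ltnn].
Qed.

Lemma place_rows D i : i < j -> rows e (map (place e s) D) (nth 0 s i) = rows j D i.
Proof.
move=> ij; rewrite /rows filter_map -map_comp.
rewrite (eq_map (f := _ \o _) place_div); congr map; apply: eq_filter => x /=.
by rewrite place_mod nth_runner_choice // ltn_mod.
Qed.

(** Positions are ordered by row first and runner second, and [s] increases. Thus the order of the
    beads does not depend on [s], which makes their differences affine in [s]. *)
Lemma ltn_place x y : x < y -> place e s x < place e s y.
Proof.
move=> xy; have [sj ss _] := sP.
rewrite (divn_eq (place e s x) e) (divn_eq (place e s y) e) !place_div !place_mod.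
have xj : x %% j < j by rewrite ltn_mod.
have yj : y %% j < j by rewrite ltn_mod.
have := leq_div2r j (ltnW xy); rewrite leq_eqVlt => /predU1P[dE|dl].
  rewrite dE ltn_add2l; apply: (sorted_ltn_nth ltn_trans 0 ss); rewrite ?inE ?sj //.
  by have := divn_eq x j; have := divn_eq y j; rewrite dE; lia.
apply: leq_trans (leq_addr _ _); apply: (@leq_trans ((x %/ j).+1 * e)).
  by rewrite mulSn addnC ltn_add2r runner_choice_lt.
by rewrite leq_mul2r dl orbT.
Qed.

Lemma place_sorted D : sorted gtn D -> sorted gtn (map (place e s) D).
Proof.
by move=> sD; rewrite sorted_map; apply: sub_sorted sD => x y /=; apply: ltn_place.
Qed.

Lemma runners_place D : (forall i, i < j -> 0 < size (rows j D i)) ->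
  runners e (map (place e s) D) = s.
Proof.
move=> Dj; have [sj ss se] := sP; apply: runners_eq => // b be.
apply/idP/idP => [bs|].
  by rewrite -(nth_index 0 bs) place_rows ?Dj // -sj index_mem.
rewrite size_rows -has_count => /hasP[_ /mapP[x _ ->]]; rewrite place_mod => /eqP <-.
by rewrite mem_nth // sj ltn_mod.
Qed.

End Place.

(** Fixing [q] fixes the bead pattern [D] on [size mu] runners. The only freedom left is which
    runners carry it, and [s] is recovered as the list of non-empty runners. *)
Lemma copyP r e w mu q D lam : 0 < e -> 0 < size mu -> 0 \notin mu ->
  is_jpartition mu w q -> sorted gtn D ->
  (forall i, i < size mu ->
    rows (size mu) D i = beta (nth 0 mu i) (nth [::] q i)) ->
  Pweight r e w mu lam /\ records r e mu lam q <->
  [/\ is_partition lam, size lam <= r &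
    exists2 s, runner_choice e (size mu) s & beta r lam = map (place e s) D].
Proof.
move=> e0 j0 mu0 qP sD DE; set j := size mu in j0 DE *; set l := beta r lam; split.
  move=> [/(PweightP e0 _ _ _ mu0)[lP sl muE lw] rec]; split=> //.
  have sr : size (runners e l) = j by rewrite /j muE size_map.
  have sP : runner_choice e j (runners e l).
    by split=> //; [apply: runners_sorted | apply/allP => b; apply: runners_lt].
  exists (runners e l) => //; apply: (eq_rows e0).
  - exact: beta_sorted.
  - exact: place_sorted sP _ sD.
  move=> b be; have [bl|bl] := boolP (b \in runners e l).
    have ij : index b (runners e l) < j by rewrite -sr index_mem.
    rewrite -(nth_index 0 bl) (place_rows e0 j0 sP) // DE //.
    by rewrite -rec.
  (* A runner outside [runners e l] carries no bead of either list, since [place] only reaches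
     chosen runners. *)
  rewrite !rows_nil // mem_runners be andbT size_rows -has_count.
  apply: contra bl => /hasP[_ /mapP[x _ ->]].
  rewrite (place_mod j0 sP) => /eqP <-.
  by rewrite mem_nth // sr ltn_mod.
move=> [lP sl [s sP lE]]; have [sj _ _] := sP.
have szD i : i < j -> size (rows j D i) = nth 0 mu i by move=> ij; rewrite DE ?size_beta.
have rs : runners e l = s.
  rewrite lE (runners_place e0 j0 sP) // => i ij; rewrite szD // lt0n.
  by apply: contraNneq mu0 => <-; apply: mem_nth.
have rec i : i < j -> rows e l (nth 0 s i) = beta (nth 0 mu i) (nth [::] q i).
  by move=> ij; rewrite lE (place_rows e0 j0 sP) // DE.
split; last first.
  by move=> i /rec {}rec; rewrite /nonempty_runners -/(runners e l) rs.
apply/(PweightP e0) => //; split=> //.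
  rewrite /runner_sizes -/l rs.
  apply: (@eq_from_nth _ 0); rewrite ?size_map ?sj // => i ij.
  by rewrite (nth_map 0) ?sj // rec // size_beta.
rewrite rowsum_rows // -/l rs -(big_map (rows e l) predT sumn).
apply: (sum_rows_jpartition qP); first by rewrite size_map sj.
by move=> i ij; rewrite (nth_map 0) ?sj // rec.
Qed.

(** * Simplices *)

(** The formula of [Omega] for an arbitrary list: [Omega r lam] is [diffs r (beta r lam)]. *)
Definition diffs (r : nat) (l : seq nat) : 'rV[int]_(r.-1) :=
  (\row_(i < r.-1) ((nth 0%N l i)%:Z - (nth 0%N l i.+1)%:Z))%R.

Section PrefixSum.
Local Open Scope ring_scope.
Variables (R : pzRingType) (d : nat).

(** If [x] lists the gaps between the chosen runners, then [s_n = s_0 + n + prefix_sum x n] for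
    [n <= d]. *)
Definition prefix_sum (x : 'rV[R]_d.+1) (n : nat) : R :=
  \sum_(t < d.+1 | (t < n)%N) x 0 t.

Lemma prefix_sum0 x : prefix_sum x 0 = 0.
Proof. by rewrite /prefix_sum big_pred0. Qed.

Lemma prefix_sumS x (t : 'I_d.+1) : prefix_sum x t.+1 = prefix_sum x t + x 0 t.
Proof.
rewrite /prefix_sum (bigD1 t) //= addrC; congr (_ + _).
by apply: eq_bigl => i; rewrite -(inj_eq val_inj) /=; lia.
Qed.

Lemma prefix_sum_full x : prefix_sum x d.+1 = \sum_t x 0 t.
Proof. by apply: eq_bigl => t; rewrite ltn_ord. Qed.

Lemma prefix_sum_inj x y :
  (forall n, (n <= d.+1)%N -> prefix_sum x n = prefix_sum y n) -> x = y.
Proof.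
move=> xy; apply/rowP => t; apply: (@addrI _ (prefix_sum x t)).
rewrite -prefix_sumS (xy t) ?(ltnW (ltn_ord t)) // -prefix_sumS.
exact/xy/ltn_ord.
Qed.

End PrefixSum.

Section SimplexPlace.
Local Open Scope ring_scope.
Variables (R : realType) (r e d : nat) (D : seq nat).
Hypotheses (de : (d < e)%N) (sD : size D = r)
  (coverD : forall i, (i < d.+1)%N -> exists2 x, x \in D & (x %% d.+1 = i)%N).

Let res k := (nth 0%N D k %% d.+1)%N.
Let quo k := (nth 0%N D k %/ d.+1)%N.

(** Gap [t] moves bead [k] exactly when it precedes the runner of that bead, that is when
    [t < res k]. *)
Definition gap_matrix : 'M[R]_(d.+1, r.-1) :=
  \matrix_(t, k) ((t < res k)%:R - (t < res k.+1)%:R).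

(** The bead differences when the first [d] gaps vanish, that is for consecutive runners. *)
Definition gap_shift : 'rV[R]_(r.-1) :=
  \row_k ((quo k * e + res k)%:R - (quo k.+1 * e + res k.+1)%:R).

Lemma mulmx_gap_matrix (x : 'rV[R]_d.+1) k :
  (x *m gap_matrix) 0 k = prefix_sum x (res k) - prefix_sum x (res k.+1).
Proof.
rewrite mxE /prefix_sum [X in X - _]big_mkcond [X in _ - X]big_mkcond -sumrB.
apply: eq_bigr => t _ /=.
by rewrite mxE mulrBr; do 2 case: ifP => _; rewrite ?mulr1 ?mulr0.
Qed.

(** Equal images make the prefix sums of [x] and [y] differ by one constant at all residues, since
    all occur in [D]. Residue 0 shows that the constant is 0, and the hyperplane supplies the last
    prefix sum. *)
Lemma gap_matrix_inj L :
  set_inj (@hyperplane R d L) (fun x => mulmxr gap_matrix x + gap_shift).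
Proof.
move=> x y; rewrite !inE /hyperplane /= => xL yL /addIr /rowP xy.
have step k : (k < r)%N -> prefix_sum x (res k) - prefix_sum y (res k) =
    prefix_sum x (res 0) - prefix_sum y (res 0).
  elim: k => // k IH kr; rewrite -IH ?(ltnW kr) //.
  have kr' : (k < r.-1)%N by lia.
  by have := xy (Ordinal kr'); rewrite !mulmx_gap_matrix /=; lra.
have const n : (n < d.+1)%N -> prefix_sum x n - prefix_sum y n =
    prefix_sum x (res 0) - prefix_sum y (res 0).
  move=> /coverD[z zD <-]; rewrite -(step (index z D)) -?sD ?index_mem //.
  by rewrite /res nth_index.
have c0 := const 0%N isT; rewrite !prefix_sum0 subrr in c0.
apply: prefix_sum_inj => n; rewrite leq_eqVlt ltnS => /predU1P[->|nd].
  by rewrite !prefix_sum_full xL yL.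
by have := const n nd; rewrite -c0 => /eqP; rewrite subr_eq0 => /eqP.
Qed.

(* The beads depend affinely on the gaps: runner i is s_0 + i + (sum of the
   first i gaps), and s_0 cancels in the differences. *)
Lemma gap_entry (x : 'rV[R]_d.+1) s : size s = d.+1 ->
  (forall i, (i < d.+1)%N ->
    (nth 0%N s i)%:R = (nth 0%N s 0)%:R + i%:R + prefix_sum x i :> R) ->
  to_real R (diffs r (map (place e s) D)) = x *m gap_matrix + gap_shift.
Proof.
move=> ss sx; apply/rowP => k.
have kr : (k.+1 < r)%N by have := ltn_ord k; lia.
rewrite [LHS]mxE mxE [RHS]mxE mulmx_gap_matrix mxE.
rewrite !(nth_map 0%N) ?sD ?(ltnW kr) // rmorphB /= -!pmulrn /place ss.
rewrite -/(res k) -/(res k.+1) -/(quo k) -/(quo k.+1) !natrD !natrM.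
by rewrite (sx (res k)) ?(sx (res k.+1)) ?ltn_mod //; ring.
Qed.

(** With the cyclic last gap included, the gaps of a runner choice total [e - d.+1]. Translated
    choices share a gap vector, but also the same differences, so only the image matters. *)
Lemma place_simplex_points : simplex_points R d (e - d.+1)
  [set diffs r (map (place e s) D) | s in [set s | runner_choice e d.+1 s]].
Proof.
exists (mulmxr gap_matrix), gap_shift => /=.
split; first exact: gap_matrix_inj.
apply/seteqP; split => [_ [_ [s [ss sS se] <-] <-]|].
  (* The default value places index [d.+1] at the first runner one turn later, so the cyclic gap
     obeys the same formula as the others. *)
  pose sx := nth (e + nth 0%N s 0)%N s.
  have sxE i : (i < d.+1)%N -> sx i = nth 0%N s i.
    by move=> id; rewrite /sx (set_nth_default 0%N) ?ss.
  have sx_d : sx d.+1 = (e + nth 0%N s 0)%N by rewrite /sx nth_default ?ss.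
  have sx_lt i : (i < d.+1)%N -> (sx i < sx i.+1)%N.
    move=> id; have [iLd|] := ltnP i.+1 d.+1.
      by rewrite !sxE //; apply: (sorted_ltn_nth ltn_trans 0%N sS); rewrite ?inE ?ss.
    move=> di; have -> : i = d by lia.
    rewrite sx_d sxE //; apply: ltn_addr.
    by move/allP: se; apply; apply: mem_nth; rewrite ss.
  pose z : 'rV[int]_d.+1 := \row_t ((sx t.+1)%:Z - (sx t)%:Z - 1).
  have pz n : (n <= d.+1)%N ->
      prefix_sum (to_real R z) n = (sx n)%:R - (sx 0%N)%:R - n%:R.
    elim: n => [|n IH nd]; first by move=> _; rewrite prefix_sum0; ring.
    rewrite (prefix_sumS _ (Ordinal nd)) IH /=; last exact: ltnW.
    by rewrite !mxE !rmorphB /= -!pmulrn -[n.+1%:R]natr1; ring.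
  exists (to_real R z); last first.
    symmetry; apply: gap_entry => // i id.
    by rewrite pz ?(ltnW id) // !sxE //; ring.
  split; last by exists z.
  split; rewrite /hyperplane /=.
    rewrite -prefix_sum_full pz // sx_d sxE // natrD natrB //; ring.
  by move=> t; rewrite !mxE ler0z; have := sx_lt t (ltn_ord t); lia.
move=> _ [x [[xL x0] [z _ xz]] <-].
pose n (t : 'I_d.+1) := absz (z 0 t).
have nE t : x 0 t = (n t)%:R.
  have := x0 t; rewrite -xz !mxE ler0z => z0.
  by rewrite -{1}(gez0_abs z0).
pose N i := (\sum_(t < d.+1 | (t < i)%N) n t)%N.
have NE i : prefix_sum x i = (N i)%:R.
  by rewrite /N natr_sum; apply: eq_bigr => t _; rewrite nE.
have Nle i k : (i <= k)%N -> (N i <= N k)%N.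
  move=> ik; rewrite /N [leqRHS](bigID (fun t : 'I_d.+1 => (t < i)%N)) /=.
  apply: leq_trans (leq_addr _ _); rewrite leq_eqVlt; apply/orP; left.
  by apply/eqP/eq_bigl => t; lia.
have Nd : N d.+1 = (e - d.+1)%N.
  by apply/eqP; rewrite -(eqr_nat R) -NE prefix_sum_full xL.
(* The choice starting at runner 0 is enough; its last runner is at most [d + (e - d.+1) < e]. *)
pose s := mkseq (fun i => i + N i)%N d.+1.
have sE i : (i < d.+1)%N -> nth 0%N s i = (i + N i)%N by move=> id; rewrite nth_mkseq.
exists (diffs r (map (place e s) D)).
  exists s => //; split; first by rewrite size_mkseq.
    apply/(sortedP 0%N) => i; rewrite size_mkseq => id.
    have := Nle _ _ (leqnSn i); have := sE _ id; have := sE _ (ltnW id).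
    by rewrite /=; lia.
  apply/(all_nthP 0%N) => i; rewrite size_mkseq => id; rewrite sE //.
  by have := Nle i d.+1 (ltnW id); rewrite Nd; lia.
apply: gap_entry; first by rewrite size_mkseq.
move=> i id; rewrite !sE // !natrD -!NE prefix_sum0; ring.
Qed.

End SimplexPlace.

(** * Copies *)

Lemma composition_size r mu : is_composition r mu -> size mu <= r.
Proof. by move=> /andP[mu0 /eqP <-]; apply: size_leq_sumn. Qed.

Lemma composition_size_gt0 r mu : 0 < r -> is_composition r mu -> 0 < size mu.
Proof. by case: mu => //= r0 /eqP r_; rewrite -r_ in r0. Qed.

(** Runner [i] of the template carries [mu_i] beads, and these add up to [r]. *)
Lemma jpartition_beads r w mu q : 0 < r -> is_composition r mu ->
  is_jpartition mu w q ->
  exists D, [/\ sorted gtn D, size D = r &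
    forall i, i < size mu ->
      rows (size mu) D i = beta (nth 0 mu i) (nth [::] q i)].
Proof.
move=> r0 mur /jpartitionP[_ qP _]; have j0 := composition_size_gt0 r0 mur.
have /andP[mu0 /eqP smu] := mur.
pose t := [seq beta (nth 0 mu i) (nth [::] q i) | i <- iota 0 (size mu)].
have st : size t = size mu by rewrite size_map size_iota.
have tS : all (sorted gtn) t.
  apply/allP => _ /mapP[i + ->]; rewrite mem_iota => /qP[qi _].
  exact: beta_sorted.
have [] := rows_exist _ tS; rewrite st // => D [sD DE]; exists D.
have {}DE i : i < size mu -> rows (size mu) D i = beta (nth 0 mu i) (nth [::] q i).
  by move=> ij; rewrite DE // (nth_map 0) ?size_iota // nth_iota.
split=> //; rewrite (size_sum_rows j0) -smu sumnE [RHS](big_nth 0).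
have -> : runners (size mu) D = iota 0 (size mu).
  apply: runners_eq => //; first exact: iota_ltn_sorted.
    by apply/allP => b; rewrite mem_iota.
  move=> b bj; rewrite mem_iota bj DE // size_beta; apply/esym.
  by rewrite lt0n; apply: contraNneq mu0 => <-; apply: mem_nth.
rewrite /index_iota subn0; apply: eq_big_seq => i; rewrite mem_iota => ij.
by rewrite DE // size_beta.
Qed.

Lemma copy_place r e w mu q D : 0 < r -> 0 < e -> is_composition r mu ->
  is_jpartition mu w q -> sorted gtn D -> size D = r ->
  (forall i, i < size mu ->
    rows (size mu) D i = beta (nth 0 mu i) (nth [::] q i)) ->
  copy r e w mu q =
  [set diffs r (map (place e s) D) | s in [set s | runner_choice e (size mu) s]].
Proof.
move=> r0 e0 mur qP sD szD DE; have j0 := composition_size_gt0 r0 mur.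
have /andP[mu0 _] := mur.
have cP lam := copyP r lam e0 j0 mu0 qP sD DE.
apply/seteqP; split => [_ [lam /cP[_ _ [s sP lE]] <-]|_ [s sP <-]].
  by exists s => //; rewrite -lE.
have [lam [lP sl lE]] := beta_surj (place_sorted e0 j0 sP sD).
rewrite size_map szD in sl lE; exists lam; last by rewrite -lE.
by apply/cP; split=> //; exists s.
Qed.

(** The parts of [mu] are positive, so every residue modulo [size mu] occurs in [D], as the
    injectivity of the affine map requires. *)
Lemma copy_simplex (R : realType) r e w mu q : 0 < r -> r < e ->
  is_composition r mu -> is_jpartition mu w q ->
  simplex_points R (size mu).-1 (e - size mu) (copy r e w mu q).
Proof.
move=> r0 re mur qP; have e0 := leq_ltn_trans (leq0n _) re.
have [D [sD szD DE]] := jpartition_beads r0 mur qP.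
rewrite (copy_place r0 e0 mur qP sD szD DE).
have := composition_size mur.
have := composition_size_gt0 r0 mur; have /andP[mu0 _] := mur.
case smu : (size mu) DE => [//|d] DE _ dr /=.
apply: place_simplex_points => //; first exact: leq_trans dr (ltnW re).
move=> i id; have : 0 < size (rows d.+1 D i).
  rewrite DE // size_beta lt0n; apply: contraNneq mu0 => <-; apply: mem_nth.
  by rewrite smu.
by rewrite size_rows -has_count => /hasP[x xD /eqP]; exists x.
Qed.

(** Since [size mu <= r < e], the first [size mu] runners are a valid choice. Non-emptiness is what
    makes disjoint copies distinct. *)
Lemma copy_nonempty r e w mu q : 0 < r -> r < e ->
  is_composition r mu -> is_jpartition mu w q -> copy r e w mu q !=set0.
Proof.
move=> r0 re mur qP; have e0 := leq_ltn_trans (leq0n _) re.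
have [D [sD szD DE]] := jpartition_beads r0 mur qP.
rewrite (copy_place r0 e0 mur qP sD szD DE).
exists (diffs r (map (place e (iota 0 (size mu))) D)), (iota 0 (size mu)) => //.
split; rewrite ?size_iota ?iota_ltn_sorted //.
apply/allP => b; rewrite mem_iota => /andP[_ bj].
exact: leq_trans bj (leq_trans (composition_size mur) (ltnW re)).
Qed.

Lemma Wweight_copies r e w mu : 0 < e -> 0 \notin mu ->
  Wweight r e w mu = \bigcup_(q in jpartitions mu w) copy r e w mu q.
Proof.
move=> e0 mu0; apply/seteqP; split => [_ [lam lP <-]|_ [q _ [lam [lP _] <-]]].
  by have [q qP rec] := jpartition_exists e0 mu0 lP; exists q => //; exists lam.
by exists lam.
Qed.

(** Equal weights give equal row lists, and [records] reads the same beta numbers, hence the same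
    j-partition, off them. *)
Lemma copy_trivIset r e w mu : 0 < e -> 0 \notin mu ->
  trivIset (jpartitions mu w) (copy r e w mu).
Proof.
move=> e0 mu0 q q' qP q'P [_ [[lam [lP rec] <-] [lam' [lP' rec'] OE]]].
apply: (jpartition_rows_inj qP q'P) => i im.
have lE := Pweight_Omega_inj e0 mu0 mu0 lP lP' (esym OE).
have sz l : mu = runner_sizes e l -> size mu = size (runners e l).
  by move=> ->; rewrite size_map.
have [_ _ /sz muE _] := (PweightP e0 r w lam mu0).1 lP.
have [_ _ /sz muE' _] := (PweightP e0 r w lam' mu0).1 lP'.
by rewrite -(records_rows rec) // -(records_rows rec') // lE.
Qed.

Lemma Wweight_disjoint r e w mu nu : 0 < e -> 0 \notin mu -> 0 \notin nu ->
  mu <> nu -> Wweight r e w mu `&` Wweight r e w nu = set0.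
Proof.
move=> e0 mu0 nu0 mn; rewrite -subset0 => _ [[lam lP <-] [lam' lP' OE]]; apply: mn.
have := Pweight_Omega_inj e0 mu0 nu0 lP lP' (esym OE).
have [_ _ -> _] := (PweightP e0 r w lam mu0).1 lP.
have [_ _ -> _] := (PweightP e0 r w lam' nu0).1 lP'.
by rewrite !runner_sizes_rows => ->.
Qed.

Definition empty_jpartition (mu : seq nat) : seq (seq nat) := nseq (size mu) [::].

Lemma empty_jpartitionP mu : is_jpartition mu 0 (empty_jpartition mu).
Proof.
have nthE i : nth [::] (empty_jpartition mu) i = [::].
  by rewrite nth_nseq; case: ifP.
apply/jpartitionP; split; first by rewrite size_nseq.
  by move=> i _; rewrite nthE.
by rewrite big1 // => i _; rewrite nthE.
Qed.

(** With no moves recorded the copy is the simplex itself, so the claim on [Wcore] becomes an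
    instance of [copy_simplex]. *)
Lemma Wcore_copy r e mu : 0 < e -> 0 \notin mu ->
  Wcore r e mu = copy r e 0 mu (empty_jpartition mu).
Proof.
move=> e0 mu0.
have bE i : i < size mu ->
    beta (nth 0 mu i) (nth [::] (empty_jpartition mu) i) =i iota 0 (nth 0 mu i).
  by move=> im; rewrite nth_nseq im; apply: beta_nil_iota.
congr image; apply/seteqP; split => lam /=.
  move=> lamC; have /(PcoreP e0 _ _ mu0)[lP sl muE lE] := lamC.
  split; first by apply/(PweightP e0) => //; split=> //; rewrite (rowsum_Pcore e0 mu0).
  move=> i im; apply: gtn_sorted_eq.
  - exact/rows_sorted/beta_sorted.
  - by rewrite nth_nseq im; apply: beta_sorted.
  have ir : i < size (runners e (beta r lam)) by rewrite muE size_map in im.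
  move=> a; rewrite bE // [LHS]lE; last by apply: runners_lt (mem_nth 0 ir).
  by rewrite muE (nth_map 0).
move=> [/(PweightP e0 _ _ _ mu0)[lP sl muE _] rec].
apply/(PcoreP e0) => //; split=> // b be.
have [bl|bl] := boolP (b \in runners e (beta r lam)); last by rewrite rows_nil.
have im : index b (runners e (beta r lam)) < size mu.
  by rewrite muE size_map index_mem.
have /= := rec _ im; rewrite -[runner_rows _ _ _ _]/(rows e (beta r lam) _).
by rewrite nth_index // => ->; rewrite size_beta; apply: bE.
Qed.

Theorem theorem3p10 (R : realType) (r e w : nat) (mu nu : seq nat)
    (hr : 3 <= r) (hre : r < e)
    (hmu : is_composition r mu) (hnu : is_composition r nu) (hne : mu <> nu) :
  Wweight r e w mu `&` Wweight r e w nu = set0 /\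
  [/\ simplex_points R (size mu).-1 (e - size mu) (Wcore r e mu),
      forall q, jpartitions mu w q ->
        simplex_points R (size mu).-1 (e - size mu) (copy r e w mu q),
      Wweight r e w mu = \bigcup_(q in jpartitions mu w) copy r e w mu q,
      trivIset (jpartitions mu w) (copy r e w mu) &
      (copy r e w mu @` jpartitions mu w #= `I_(A mu w))%card].
Proof.
have r0 : 0 < r by apply: leq_trans hr.
have e0 : 0 < e by apply: ltn_trans hre.
have /andP[mu0 _] := hmu; have /andP[nu0 _] := hnu.
have disj := @copy_trivIset r e w mu e0 mu0.
split; first exact: Wweight_disjoint.
split=> //.
- by rewrite Wcore_copy //; apply: copy_simplex => //; apply: empty_jpartitionP.
- by move=> q qP; apply: copy_simplex.
- exact: Wweight_copies.
(* If two copies coincide, their intersection is a copy, hence non-empty, and disjointness forces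
   [q = q']; so counting copies is counting j-partitions. *)
- have inj : {in jpartitions mu w &, injective (copy r e w mu)}.
    move=> q q'; rewrite !inE => qP q'P qq'; apply: disj => //.
    by rewrite -qq' setIid; apply: copy_nonempty.
  apply: card_eq_trans (inj_card_eq inj) _.
  apply/fcard_eq; [exact: finite_jpartitions | exact: finite_II | ].
  by apply/esym/card_fset_set.
Qed.
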